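(* Let $G$ be a processive graph with a linear order $\prec$ on $E(G)$ satisfying $(P_1)$ $e_1\rightarrow e_2$ implies $e_1\prec e_2$. Then the following statements are equivalent: (1) $(G,\prec)$ is a POP-graph. (2) $\prec$ satisfies $(U_2)$ and $(P_3)$. (3) $(G,\prec)$ is an anchored UPO-graph. (4) $\prec$ satisfies $(U_2)$, $(U_3)$ and $(U_4)$. Here the conditions are: $(U_2)$ for any vertex $v$, $\overline{I(v)}\cap\overline{O(v)}=\emptyset$ and $\overline{E(v)}=\overline{I(v)}\sqcup\overline{O(v)}$; $(U_3)$ for any two vertices $v_1,v_2$, $I(v_1)\cap\overline{I(v_2)}\neq\emptyset$ implies $\overline{I(v_1)}\subseteq\overline{I(v_2)}$, and $O(v_1)\cap\overline{O(v_2)}\neq\emptyset$ implies $\overline{O(v_1)}\subseteq\overline{O(v_2)}$; $(U_4)$ for any processive vertex $v$ of $G$, $I(G)\cap\overline{O(v)}=\emptyset$ and $O(G)\cap\overline{I(v)}=\emptyset$; $(P_3)$ for any two distinct vertices $v_1,v_2$, $I(v_1)\cap\overline{I(v_2)}\neq\emptyset$ implies $v_1\rightarrow v_2$, and $O(v_1)\cap\overline{O(v_2)}\neq\emptyset$ implies $v_2\rightarrow v_1$.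
   Context: Directed graphs are finite; parallel edges are allowed. For a vertex $v$, $I(v)$ and $O(v)$ are the sets of incoming and outgoing edges and $E(v)=I(v)\cup O(v)$. A source (sink) is a vertex with no incoming (outgoing) edge. A processive graph is an acyclic directed graph in which all sources and sinks have degree one; a vertex is processive if it is neither a source nor a sink. $I(G)$ is the set of input edges (edges starting from a source) and $O(G)$ the set of output edges (edges ending with a sink). For edges $e_1\ne e_2$, $e_1\rightarrow e_2$ means there is a directed path with first edge $e_1$ and last edge $e_2$; for vertices, $v\rightarrow w$ means there is a (nontrivial) directed path starting from $v$ and ending with $w$. For a finite set with a linear order $\prec$ and nonempty subset $X$, $X^-=\min X$, $X^+=\max X$, $\overline{X}=\{y: X^-\preceq y\preceq X^+\}$; $\overline{\emptyset}=\emptyset$. A planar order on a processive graph $G$ is a linear order $\prec$ on $E(G)$ such that $(P_1)$ $e_1\rightarrow e_2$ implies $e_1\prec e_2$; $(P_2)$ if $e_1\prec e_2\prec e_3$ and $e_1\rightarrow e_3$, then $e_1\rightarrow e_2$ or $e_2\rightarrow e_3$. A POP-graph is a processive graph together with a planar order. An upward planar order on a directed graph $G$ is a linear order $\prec$ on $E(G)$ satisfying $(U_1)=(P_1)$, $(U_2)$ and $(U_3)$; a UPO-graph is a directed graph with an upward planar order. A UPO-graph is anchored if $(A)$: for any different vertices $v_1,v_2$, $\emptyset\neq\overline{I(v_1)}\subset\overline{I(v_2)}$ implies $v_1\rightarrow v_2$, and $\emptyset\neq\overline{O(v_1)}\subset\overline{O(v_2)}$ implies $v_2\rightarrow v_1$.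 *)

(* Defs.v *)
From mathcomp Require Import all_boot all_order.

Set Implicit Arguments.
Unset Strict Implicit.
Unset Printing Implicit Defensive.

Import Order.TTheory.
Local Open Scope order_scope.

Record digraph (V E : finType) := Digraph { src : E -> V; tgt : E -> V }.

Section Digraph.

Variables (V E : finType) (G : digraph V E).

Definition inE_at (v : V) : {set E} := [set e | tgt G e == v].
Definition outE_at (v : V) : {set E} := [set e | src G e == v].
Definition E_at (v : V) : {set E} := inE_at v :|: outE_at v.

Definition degree (v : V) : nat := #|inE_at v| + #|outE_at v|.

Definition is_source (v : V) : bool := inE_at v == set0.
Definition is_sink (v : V) : bool := outE_at v == set0.

Definition edge_adj : rel E := [rel e1 e2 | tgt G e1 == src G e2].

(* [connect edge_adj e1 e2] says that there is a nonempty directed path whose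
   first edge is e1 and whose last edge is e2 (a single edge if e1 = e2). *)
Definition edge_reach : rel E :=
  [rel e1 e2 | (e1 != e2) && connect edge_adj e1 e2].

Definition vertex_reach : rel V :=
  [rel v w | [exists e1, exists e2,
     [&& src G e1 == v, tgt G e2 == w & connect edge_adj e1 e2]]].

Definition acyclic : Prop := forall v : V, ~~ vertex_reach v v.

Definition processive_graph : Prop :=
  acyclic /\ forall v : V, is_source v || is_sink v -> degree v = 1%N.

Definition processive_vertex (v : V) : bool := ~~ is_source v && ~~ is_sink v.

Definition input_edges : {set E} := [set e | is_source (src G e)].
Definition output_edges : {set E} := [set e | is_sink (tgt G e)].

End Digraph.

Section Hull.

Variables (d : Order.disp_t) (E : finOrderType d).

Definition is_min (X : {set E}) (a : E) : bool :=
  (a \in X) && [forall x in X, a <= x].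
Definition is_max (X : {set E}) (b : E) : bool :=
  (b \in X) && [forall x in X, x <= b].

(* The interval from min X to max X; it is empty when X is empty, because then
   no a and b satisfy the condition. *)
Definition hull (X : {set E}) : {set E} :=
  [set y | [exists a, exists b, [&& is_min X a, is_max X b & a <= y <= b]]].

End Hull.

(* The linear order on the edges is the canonical order of the type E. *)
Section PlanarOrders.

Variables (d : Order.disp_t) (V : finType) (E : finOrderType d).
Variable G : digraph V E.

Local Notation I := (inE_at G).
Local Notation O := (outE_at G).

Definition P1 : Prop := forall e1 e2 : E, edge_reach G e1 e2 -> e1 < e2.

Definition P2 : Prop :=
  forall e1 e2 e3 : E, e1 < e2 -> e2 < e3 -> edge_reach G e1 e3 ->
    edge_reach G e1 e2 \/ edge_reach G e2 e3.

Definition P3 : Prop :=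
  forall v1 v2 : V, v1 <> v2 ->
    (I v1 :&: hull (I v2) <> set0 -> vertex_reach G v1 v2) /\
    (O v1 :&: hull (O v2) <> set0 -> vertex_reach G v2 v1).

Definition U2 : Prop :=
  forall v : V,
    hull (I v) :&: hull (O v) = set0 /\
    hull (E_at G v) = hull (I v) :|: hull (O v).

Definition U3 : Prop :=
  forall v1 v2 : V,
    (I v1 :&: hull (I v2) <> set0 -> hull (I v1) \subset hull (I v2)) /\
    (O v1 :&: hull (O v2) <> set0 -> hull (O v1) \subset hull (O v2)).

Definition U4 : Prop :=
  forall v : V, processive_vertex G v ->
    input_edges G :&: hull (O v) = set0 /\
    output_edges G :&: hull (I v) = set0.

(* Strict and nonstrict inclusion agree here: for v1 <> v2 the sets I v1 and
   I v2 are disjoint, so nonempty hulls of them have different minima. *)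
Definition anchored : Prop :=
  forall v1 v2 : V, v1 <> v2 ->
    (hull (I v1) <> set0 -> hull (I v1) \subset hull (I v2) ->
       vertex_reach G v1 v2) /\
    (hull (O v1) <> set0 -> hull (O v1) \subset hull (O v2) ->
       vertex_reach G v2 v1).

Definition planar_order : Prop := P1 /\ P2.
Definition POP_graph : Prop := processive_graph G /\ planar_order.

Definition UPO_graph : Prop := [/\ P1, U2 & U3].
Definition anchored_UPO_graph : Prop := UPO_graph /\ anchored.

End PlanarOrders.

(* Main.v *)
Require Import Defs.
From mathcomp Require Import all_boot all_order.

Set Implicit Arguments.
Unset Strict Implicit.
Unset Printing Implicit Defensive.

Import Order.TTheory.
Local Open Scope order_scope.

(** All conditions come in pairs exchanged by reversing both the edges and the
    order, so only one half of each needs an argument.  The key step is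
    (4) => (1): under (U2), (U3), (U4) every edge [e] of the hull of [O v] is
    reached from [O v].  Indeed, if [e] is not in [O v], then its source [w] is
    not a source of [G] by (U4), [O w] lies in the hull of [O v] by (U3), and
    by (U2) some edge of [I w] lies in that hull too; it precedes [e], so
    induction applies.  If [e1 < e2 < e3] and [e1 -> e3], then [e2] lies on the
    path from [e1] to [e3] or falls between two consecutive edges of it, hence,
    by (U2), in the hull of [I v] or of [O v] for the vertex [v] joining them. *)

(** * Hulls of sets in a finite linear order *)

Section Hull.

Variables (d : Order.disp_t) (E : finOrderType d).
Implicit Types (X Y : {set E}) (a b x : E).

Lemma hullP X x :
  reflect (exists a b, [/\ is_min X a, is_max X b, a <= x & x <= b])
          (x \in hull X).
Proof.
rewrite inE; apply: (iffP existsP) => [[a /existsP[b]]|[a [b [ha hb ax xb]]]].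
  by case/and3P=> ha hb /andP[ax xb]; exists a, b.
by exists a; apply/existsP; exists b; rewrite ha hb ax xb.
Qed.

Lemma is_minP X a : reflect (a \in X /\ forall x, x \in X -> a <= x) (is_min X a).
Proof. by apply: (iffP andP) => -[aX /forall_inP]. Qed.

Lemma is_maxP X b : reflect (b \in X /\ forall x, x \in X -> x <= b) (is_max X b).
Proof. by apply: (iffP andP) => -[bX /forall_inP]. Qed.

Lemma mem_hull X a b x : a \in X -> b \in X -> a <= x -> x <= b -> x \in hull X.
Proof.
move=> aX bX ax xb; apply/hullP.
case: (arg_minP id aX) => m mX hm; case: (arg_maxP id bX) => M MX hM.
exists m, M; split; first by apply/is_minP.
- by apply/is_maxP.
- exact: le_trans (hm _ aX) ax.
- exact: le_trans xb (hM _ bX).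
Qed.

Lemma hull_inv X x :
  x \in hull X -> exists a b, [/\ a \in X, b \in X, a <= x & x <= b].
Proof. by case/hullP=> a [b [/is_minP[aX _] /is_maxP[bX _] ax xb]]; exists a, b. Qed.

Lemma sub_hull X : X \subset hull X.
Proof. by apply/subsetP=> x xX; apply: (mem_hull xX xX). Qed.

(** A hull is an interval, so it contains all that lies between two of its elements. *)
Lemma hull_sub X Y : X \subset hull Y -> hull X \subset hull Y.
Proof.
move/subsetP=> XY; apply/subsetP=> x /hull_inv[a [b [aX bX ax xb]]].
have [a' [_ [a'Y _ a'a _]]] := hull_inv (XY a aX).
have [_ [b' [_ b'Y _ bb']]] := hull_inv (XY b bX).
exact: (mem_hull a'Y b'Y (le_trans a'a ax) (le_trans xb bb')).
Qed.

Lemma hullS X Y : X \subset Y -> hull X \subset hull Y.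
Proof. by move=> XY; apply/hull_sub/(subset_trans XY)/sub_hull. Qed.

End Hull.

Lemma hull_dual (d : Order.disp_t) (E : finOrderType d) (X : {set E}) :
  @hull _ E^d X = hull X.
Proof.
(* In [E^d] minimum and maximum trade roles, hence the swapped witnesses. *)
apply/setP=> x; apply/(@hullP _ E^d)/(@hullP _ E)=> -[a [b [ha hb ax xb]]];
  by exists b, a.
Qed.

(** * Directed paths between edges and between vertices *)

Section Reachability.

Variables (V E : finType) (G : digraph V E).
Local Notation I := (inE_at G).
Local Notation O := (outE_at G).
Local Notation reach := (connect (edge_adj G)).

(** Since [e != f], a path from [e] to [f] has a second edge, and this is [o]. *)
Lemma reach_out v e f : e \in I v -> e != f -> reach e f ->
  exists2 o, o \in O v & reach o f.
Proof.
rewrite inE => /eqP ev nef /connectP[[|o p] /= + def_f].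
  by rewrite def_f eqxx in nef.
case/andP=> /eqP eo po; exists o; first by rewrite inE -eo ev.
by apply/connectP; exists p.
Qed.

Lemma reach_step v e f : e \in I v -> f \in O v -> reach e f.
Proof. by rewrite !inE => /eqP ev /eqP fv; apply: connect1; rewrite /edge_adj /= ev fv. Qed.

Lemma vertex_reachP v w :
  reflect (exists e f, [/\ e \in O v, f \in I w & reach e f])
          (vertex_reach G v w).
Proof.
apply: (iffP existsP) => [[e /existsP[f /and3P[ev fw ef]]]|[e [f]]].
  by exists e, f; rewrite !inE.
by rewrite !inE => -[ev fw ef]; exists e; apply/existsP; exists f; apply/and3P.
Qed.

Lemma vertex_reach_trans u v w :
  vertex_reach G u v -> vertex_reach G v w -> vertex_reach G u w.
Proof.
move=> /vertex_reachP[e [f [eu fv ef]]] /vertex_reachP[e' [f' [e'v f'w ef']]].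
apply/vertex_reachP; exists e, f'; split=> //.
exact: connect_trans ef (connect_trans (reach_step fv e'v) ef').
Qed.

End Reachability.

(** Typing the edges by [E^d] reverses the order together with the arrows, so (P1) and (P2) carry
    over. *)
Definition dual_graph (d : Order.disp_t) (V : finType) (E : finOrderType d)
  (G : digraph V E) : digraph V E^d := Digraph (tgt G) (src G).

(** * Invariance of the notions under reversal *)

Section Dual.

Variables (d : Order.disp_t) (V : finType) (E : finOrderType d).
Variable G : digraph V E.
Local Notation G' := (dual_graph G).

Lemma connect_dual e f :
  connect (edge_adj G') e f = connect (edge_adj G) f e.
Proof.
rewrite connect_rev; apply: eq_connect => x y /=; exact: eq_sym.
Qed.

Lemma vertex_reach_dual v w : vertex_reach G' v w = vertex_reach G w v.
Proof.
apply/vertex_reachP/vertex_reachP=> -[e [f [ev fw ef]]]; exists f, e;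
  by split=> //; rewrite connect_dual in ef *.
Qed.

Lemma edge_reach_dual e f : edge_reach G' e f = edge_reach G f e.
Proof. by rewrite /edge_reach /= connect_dual eq_sym. Qed.

Lemma P1_dual : P1 G -> P1 G'.
Proof. by move=> h e f; rewrite edge_reach_dual; apply: h. Qed.

Lemma P2_dual : P2 G -> P2 G'.
Proof.
move=> h e f g ef fg; rewrite !edge_reach_dual => ge.
by case: (h g f e fg ef ge); [right | left].
Qed.

Lemma processive_graph_dual : processive_graph G -> processive_graph G'.
Proof.
case=> ac h; split=> v; first by rewrite vertex_reach_dual.
by rewrite orbC /degree addnC; apply: h.
Qed.

Lemma processive_vertex_dual v : processive_vertex G v -> processive_vertex G' v.
Proof. by rewrite /processive_vertex andbC. Qed.

End Dual.

(** * One half of each implication *)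

Section OneSided.

Variables (d : Order.disp_t) (V : finType) (E : finOrderType d).
Variable G : digraph V E.
Hypotheses (hG : processive_graph G) (h1 : P1 G).
Local Notation I := (inE_at G).
Local Notation O := (outE_at G).
Local Notation reach := (connect (edge_adj G)).

Lemma reach_le e f : reach e f -> e <= f.
Proof.
case: (eqVneq e f) => [->|nef] // ef.
by apply/ltW/h1/andP.
Qed.

(** (P1) needs distinct edges; an edge both entering and leaving [v] would be a loop, against
    acyclicity. *)
Lemma in_lt_out v e f : e \in I v -> f \in O v -> e < f.
Proof.
move=> ev fv; apply: h1; rewrite /edge_reach /= (reach_step ev fv) andbT.
apply: contraTneq fv => <-; apply/negP=> e_out; have [ac _] := hG.
have /negP[] := ac v.
by apply/vertex_reachP; exists e, e; split.
Qed.

Lemma hull_in_lt_out v e f : e \in hull (I v) -> f \in hull (O v) -> e < f.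
Proof.
move=> /hull_inv[_ [i [_ iv _ ei]]] /hull_inv[o [_ [ov _ of_ _]]].
exact: le_lt_trans ei (lt_le_trans (in_lt_out iv ov) of_).
Qed.

(** A sink has degree one, so it cannot receive two edges. *)
Lemma processive_of_in2 v e f : e \in I v -> f \in I v -> e != f ->
  processive_vertex G v.
Proof.
move=> ev fv nef; apply/andP; rewrite /is_source /is_sink; split.
  by apply/set0Pn; exists e.
apply/negP=> sink; have [_ /(_ v)] := hG.
rewrite /is_sink sink orbT /degree (eqP sink) cards0 addn0 => /(_ isT) /eqP.
case/cards1P=> x Ix; move: ev fv nef.
by rewrite Ix !inE => /eqP-> /eqP->; rewrite eqxx.
Qed.

Lemma U2_of_P2 : P2 G -> U2 G.
Proof.
move=> h2 v; split.
  apply/setP=> x; rewrite in_set0 in_setI; apply/negP=> /andP[xI xO].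
  by have := hull_in_lt_out xI xO; rewrite ltxx.
apply/setP=> x; rewrite in_setU; apply/idP/idP; last first.
  by case/orP; apply/subsetP/hullS; rewrite ?subsetUl ?subsetUr.
case/hull_inv=> a [b []]; rewrite !in_setU => aE bE ax xb.
case/orP: aE => a_v; case/orP: bE => b_v.
- by rewrite (mem_hull a_v b_v).
- move: ax; rewrite le_eqVlt => /predU1P[<-|ax].
    by rewrite (mem_hull a_v a_v).
  move: xb; rewrite le_eqVlt => /predU1P[->|xb].
    by rewrite orbC (mem_hull b_v b_v).
  have ab : edge_reach G a b.
    apply/andP; split; first by rewrite lt_eqF ?(lt_trans ax xb).
    exact: reach_step a_v b_v.
  (* A path from [a] to [x] leaves [v] by an edge below [x], which puts [x] in the hull of [O v]; a
     path from [x] to [b] puts it in that of [I v]. *)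
  case: (h2 a x b ax xb ab) => /andP[nx r].
    have [o ov /reach_le ox] := reach_out a_v nx r.
    by rewrite orbC (mem_hull ov b_v) // ltW.
  have nx' : b != x by rewrite eq_sym.
  rewrite -(connect_dual G) in r.
  (* In the reversed graph [reach_out] gives the edge just before [b] on a path from [x]. *)
  have [i iv] := @reach_out _ _ (dual_graph G) v b x b_v nx' r.
  rewrite connect_dual => /reach_le xi.
  by rewrite (mem_hull a_v iv) // ltW.
- by have := lt_le_trans (in_lt_out b_v a_v) (le_trans ax xb); rewrite ltxx.
- by rewrite orbC (mem_hull a_v b_v).
Qed.

Lemma P3_in_of_P2 : P2 G -> forall v1 v2, v1 <> v2 ->
  I v1 :&: hull (I v2) <> set0 -> vertex_reach G v1 v2.
Proof.
move=> h2 v1 v2 nv /eqP/set0Pn[e]; rewrite in_setI => /andP[ev1 eI2].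
have [a [b [av2 bv2 ae eb]]] := hull_inv eI2.
have notI f : f \in I v2 -> f != e.
  apply: contraTneq => ->; apply/negP; rewrite inE => /eqP ev2.
  by move: ev1; rewrite inE ev2 => /eqP; apply/nesym.
have {}ae : a < e by rewrite lt_neqAle notI.
have {}eb : e < b by rewrite lt_neqAle eq_sym notI.
have nab : a != b by rewrite lt_eqF // (lt_trans ae).
(* An edge [o] leaving [v2] provides a pair [a], [o] around [e] to which (P2) applies. *)
have /andP[_ /set0Pn[o ov2]] := processive_of_in2 av2 bv2 nab.
have eo : e < o := lt_trans eb (in_lt_out bv2 ov2).
have ao : edge_reach G a o.
  apply/andP; split; first by rewrite lt_eqF ?(lt_trans ae).
  exact: reach_step av2 ov2.
case: (h2 a e o ae eo ao) => /andP[ne r].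
  (* A path from [a] to [e] would leave [v2] by an edge below [b], although [b] enters [v2]. *)
  have [o' o'v2 /reach_le o'e] := reach_out av2 ne r.
  by have := lt_trans (in_lt_out bv2 o'v2) (le_lt_trans o'e eb); rewrite ltxx.
have ne' : o != e by rewrite eq_sym.
rewrite -(connect_dual G) in r.
have [i iv2] := @reach_out _ _ (dual_graph G) v2 o e ov2 ne' r.
rewrite connect_dual => ei.
have nei : e != i by rewrite eq_sym notI.
have [f fv1 fi] := reach_out ev1 nei ei.
by apply/vertex_reachP; exists f, i.
Qed.

(** The path from [v1] to [v2] bounds [I v1] above by an edge of [I v2]. If some [e'] in [I v1]
    preceded [a] in [I v2], then [a] would lie in the hull of [I v1], and (P3) would close a
    cycle. *)
Lemma U3_in_of_P3 :
  (forall v1 v2, v1 <> v2 ->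
     I v1 :&: hull (I v2) <> set0 -> vertex_reach G v1 v2) ->
  forall v1 v2, I v1 :&: hull (I v2) <> set0 -> hull (I v1) \subset hull (I v2).
Proof.
move=> h3 v1 v2; case: (eqVneq v1 v2) => [->|/eqP nv] // hv.
have r12 := h3 _ _ nv hv; apply/hull_sub/subsetP=> e' e'v1.
move/eqP/set0Pn: hv => [e]; rewrite in_setI => /andP[ev1 /hull_inv].
case=> a [_ [av2 _ ae _]].
have /vertex_reachP[f [g [fv1 gv2 /reach_le fg]]] := r12.
have e'g : e' <= g := ltW (lt_le_trans (in_lt_out e'v1 fv1) fg).
case: (leP a e') => [ae'|/ltW e'a]; first exact: mem_hull av2 gv2 ae' e'g.
have r21 : vertex_reach G v2 v1.
  apply: h3; first exact: nesym.
  apply/eqP/set0Pn; exists a; rewrite in_setI av2.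
  exact: mem_hull e'v1 ev1 e'a ae.
have [ac _] := hG.
by have /negP[] := ac v1; apply: vertex_reach_trans r12 r21.
Qed.

Lemma anchored_in_of_P3 :
  (forall v1 v2, v1 <> v2 ->
     I v1 :&: hull (I v2) <> set0 -> vertex_reach G v1 v2) ->
  forall v1 v2, v1 <> v2 -> hull (I v1) <> set0 ->
    hull (I v1) \subset hull (I v2) -> vertex_reach G v1 v2.
Proof.
move=> h3 v1 v2 nv /eqP/set0Pn[x /hull_inv[e [_ [ev1 _ _ _]]]] /subsetP h12.
apply: h3 => //; apply/eqP/set0Pn; exists e; rewrite in_setI ev1.
exact/h12/(subsetP (sub_hull _)).
Qed.

(** If an input edge lay in the hull of [O v], anchoring would give a path from [v] to its source,
    which no edge enters. *)
Lemma U4_out_of_anchored :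
  (forall v1 v2, O v1 :&: hull (O v2) <> set0 ->
     hull (O v1) \subset hull (O v2)) ->
  (forall v1 v2, v1 <> v2 -> hull (O v1) <> set0 ->
     hull (O v1) \subset hull (O v2) -> vertex_reach G v2 v1) ->
  forall v, processive_vertex G v -> input_edges G :&: hull (O v) = set0.
Proof.
move=> h3 ha v /andP[nsv _]; apply/setP=> e; rewrite in_set0 in_setI inE.
apply/negP=> /andP[es ev]; have eO : e \in O (src G e) by rewrite inE.
have /vertex_reachP[_ [f [_ fI _]]] : vertex_reach G v (src G e).
  apply: ha.
  - by move=> sv; rewrite -sv es in nsv.
  - by apply/eqP/set0Pn; exists e; apply: (subsetP (sub_hull _)).
  - by apply: h3; apply/eqP/set0Pn; exists e; rewrite in_setI eO.
by rewrite (eqP es) inE in fI.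
Qed.

Lemma reach_hull_out :
  U2 G ->
  (forall v1 v2, O v1 :&: hull (O v2) <> set0 ->
     hull (O v1) \subset hull (O v2)) ->
  (forall v, processive_vertex G v -> input_edges G :&: hull (O v) = set0) ->
  forall v, processive_vertex G v ->
  forall e, e \in hull (O v) -> exists2 o, o \in O v & reach o e.
Proof.
move=> h2 h3 h4 v pv e.
(* Induction on the number of edges before [e]. *)
have [n] := ubnP #|[set x | x < e]|; elim: n e => // n IHn e le_n ev.
have [eO|neO] := boolP (e \in O v); first by exists e.
have eOw : e \in O (src G e) by rewrite inE.
set w := src G e in eOw.
have subO : hull (O w) \subset hull (O v).
  by apply: h3; apply/eqP/set0Pn; exists e; rewrite in_setI eOw.
suff [i iw iv] : exists2 i, i \in I w & i \in hull (O v).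
  have ie := in_lt_out iw eOw.
  have [|o ov oi] := IHn i _ iv.
    rewrite -ltnS; apply: leq_trans le_n; rewrite ltnS.
    apply: proper_card; apply/properP; split.
      by apply/subsetP=> x; rewrite !inE => /lt_trans; apply.
    by exists i; rewrite inE ?ltxx.
  by exists o => //; apply: connect_trans oi (reach_step iw eOw).
have [i iw] : exists i, i \in I w.
  apply/set0Pn; apply/negP=> sw; move/setP/(_ e): (h4 v pv).
  by rewrite in_setI ev inE /is_source sw in_set0.
have /hullP[a [b [/is_minP[av amin] /is_maxP[bv _] ae eb]]] := ev.
have ie := in_lt_out iw eOw.
(* If [i] precedes the minimum [a] of [O v], then [a] lies between [i] and [e], so (U2) at [w] puts
   it in the hull of [I w] or of [O w]. *)
case: (leP a i) => [ai|/ltW ia].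
  by exists i => //; apply: mem_hull av bv ai (le_trans (ltW ie) eb).
have : a \in hull (E_at G w).
  by apply: mem_hull ia ae; rewrite in_setU ?iw ?eOw ?orbT.
have [_ ->] := h2 w; rewrite in_setU => /orP[|aO].
  case/hull_inv=> _ [j [_ jw _ aj]]; exists j => //.
  exact: mem_hull av bv aj (le_trans (ltW (in_lt_out jw eOw)) eb).
(* Here [o] lies in the hull of [O v] and below its minimum [a], so [o = a] and [w = v], contrary to
   the choice of [e] outside [O v]. *)
have [o [_ [ow _ oa _]]] := hull_inv aO.
have /hull_inv[a' [_ [a'v _ a'o _]]] := subsetP subO o (subsetP (sub_hull _) _ ow).
have def_a : o = a by apply: le_anti; rewrite oa (le_trans (amin _ a'v)).
move: ow av neO; rewrite def_a !inE => /eqP-> /eqP wv.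
by rewrite -/w wv eqxx.
Qed.

End OneSided.

(** * The other halves by reversal, and the return to (P2) *)

Section Dualization.

Variables (d : Order.disp_t) (V : finType) (E : finOrderType d).
Variable G : digraph V E.
Hypotheses (hG : processive_graph G) (h1 : P1 G).
Local Notation I := (inE_at G).
Local Notation O := (outE_at G).
Let hG' := processive_graph_dual hG.
Let h1' := P1_dual h1.

Lemma P3_of_P2 : P2 G -> P3 G.
Proof.
move=> h2 v1 v2 nv; split; first exact: P3_in_of_P2.
have := @P3_in_of_P2 _ _ _ _ hG' h1' (P2_dual h2) v1 v2 nv.
by rewrite hull_dual vertex_reach_dual.
Qed.

Lemma P3_dual : P3 G -> P3 (dual_graph G).
Proof.
move=> h3 v1 v2 nv; rewrite !hull_dual !vertex_reach_dual.
by have [] := h3 v1 v2 nv.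
Qed.

Lemma U2_dual : U2 G -> U2 (dual_graph G).
Proof.
move=> h2 v; rewrite !hull_dual /E_at setUC.
by have [hI hE] := h2 v; rewrite setIC hI -/(E_at G v) hE setUC.
Qed.

Lemma U3_of_P3 : P3 G -> U3 G.
Proof.
move=> h3 v1 v2; split.
  by apply: U3_in_of_P3 => // u w nuw; have [] := h3 u w nuw.
have := @U3_in_of_P3 _ _ _ _ hG' h1' _ v1 v2.
rewrite !hull_dual; apply=> u w nuw.
by have [] := P3_dual h3 nuw.
Qed.

Lemma anchored_of_P3 : P3 G -> anchored G.
Proof.
move=> h3 v1 v2 nv; split.
  by apply: anchored_in_of_P3 => // u w nuw; have [] := h3 u w nuw.
have := @anchored_in_of_P3 _ _ _ (dual_graph G) _ v1 v2 nv.
rewrite !hull_dual vertex_reach_dual; apply=> u w nuw.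
by have [] := P3_dual h3 nuw.
Qed.

Lemma U4_of_anchored : U3 G -> anchored G -> U4 G.
Proof.
move=> h3 ha v pv; split.
  by apply: U4_out_of_anchored pv => [u w|u w nuw];
    [have [] := h3 u w | have [] := ha u w nuw].
have := @U4_out_of_anchored _ _ _ (dual_graph G) _ _ v (processive_vertex_dual pv).
rewrite hull_dual; apply=> [u w|u w nuw]; rewrite !hull_dual.
  by have [] := h3 u w.
by rewrite vertex_reach_dual; have [] := ha u w nuw.
Qed.

Lemma reach_hull_in : U2 G -> U3 G -> U4 G ->
  forall v, processive_vertex G v ->
  forall e, e \in hull (I v) ->
  exists2 i, i \in I v & connect (edge_adj G) e i.
Proof.
move=> h2 h3 h4 v pv e ev.
have [] := @reach_hull_out _ _ _ (dual_graph G) hG' h1' (U2_dual h2) _ _ v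
             (processive_vertex_dual pv) e.
- by move=> u w; rewrite !hull_dual; have [] := h3 u w.
- move=> u /(@processive_vertex_dual _ _ _ (dual_graph G)) pu.
  by rewrite hull_dual; have [] := h4 u pu.
- by rewrite hull_dual.
by move=> i iv; rewrite connect_dual; exists i.
Qed.

Lemma P2_of_U : U2 G -> U3 G -> U4 G -> P2 G.
Proof.
move=> h2 h3 h4 e1 e2 e3 e12 e23 /andP[_ /connectP[p]].
elim: p e1 e12 => [|f p IHp] e1 e12 /=.
  by move=> _ def_e3; move: (lt_trans e12 e23); rewrite def_e3 ltxx.
case/andP=> e1f pf def_e3.
have ne12 : e1 != e2 by rewrite lt_eqF.
have ne23 : e2 != e3 by rewrite lt_eqF.
have r1f : connect (edge_adj G) e1 f := connect1 e1f.
have rf3 : connect (edge_adj G) f e3 by apply/connectP; exists p.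
(* The second edge [f] of the path is compared with [e2]: induction if it comes before, (U2) at the
   vertex joining [e1] and [f] if it comes after. *)
case: (ltgtP f e2) => [f2|f2|def_f].
- case: (IHp f f2 pf def_e3) => [/andP[_ rf2]|]; last by right.
  by left; apply/andP; split=> //; apply: connect_trans r1f rf2.
- pose v := tgt G e1.
  have e1v : e1 \in I v by rewrite inE.
  have fv : f \in O v by rewrite inE eq_sym.
  have pv : processive_vertex G v.
    by apply/andP; split; apply/set0Pn; [exists e1 | exists f].
  have : e2 \in hull (E_at G v).
    by apply: mem_hull (ltW e12) (ltW f2); rewrite in_setU ?e1v ?fv ?orbT.
  have [_ ->] := h2 v; rewrite in_setU => /orP[e2v|e2v].
    have [i iv r2i] := reach_hull_in h2 h3 h4 pv e2v.
    right; apply/andP; split=> //; apply: connect_trans r2i _.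
    exact: connect_trans (reach_step iv fv) rf3.
  have [|u pu|o ov ro2] := reach_hull_out hG h1 h2 _ _ pv e2v.
  + by move=> u w; have [] := h3 u w.
  + by have [] := h4 u pu.
  left; apply/andP; split=> //.
  exact: connect_trans (reach_step e1v ov) ro2.
- by left; apply/andP; split=> //; rewrite -def_f.
Qed.

End Dualization.

(** * The cycle of implications through the four conditions *)

Theorem theorem4p6 (d : Order.disp_t) (V : finType) (E : finOrderType d)
    (G : digraph V E) (hG : processive_graph G) (h1 : P1 G) :
  [<-> POP_graph G;
       U2 G /\ P3 G;
       anchored_UPO_graph G;
       [/\ U2 G, U3 G & U4 G]].
Proof.
tfae.
- by case=> _ [_ h2]; split; [apply: U2_of_P2 | apply: P3_of_P2].
- case=> h2 h3; split; last exact: anchored_of_P3.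
  by split=> //; apply: U3_of_P3.
- by case=> -[_ h2 h3] ha; split=> //; apply: U4_of_anchored.
- by case=> h2 h3 h4; split=> //; split=> //; apply: P2_of_U.
Qed.
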